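(* Let $(X,\mu)$ be a finite non-atomic measure space, $\mathcal H$ a separable Hilbert space, and $\{\phi_t\}_{t\in X}$ a continuous Bessel family in $\mathcal H$. Then for every measurable function $\tau:X\to[0,1]$ and every $\varepsilon>0$ there exists a measurable set $E\subset X$ such that $$\|S_{\phi,E}-S_{\sqrt{\tau}\phi,X}\|\le\varepsilon\qquad\text{and}\qquad\mu(E)\le\int_X\tau\,d\mu.$$
   Context: A family $\{\phi_t\}_{t\in X}$ of vectors in $\mathcal H$ is a continuous Bessel family (with bound $B$) over the measure space $(X,\mu)$ if (i) for each $f\in\mathcal H$ the function $t\mapsto\langle f,\phi_t\rangle$ is measurable, and (ii) there is $B<\infty$ with $\int_X|\langle f,\phi_t\rangle|^2\,d\mu(t)\le B\|f\|^2$ for all $f\in\mathcal H$. For measurable $E\subset X$, the partial frame operator is $S_{\phi,E}f=\int_E\langle f,\phi_t\rangle\phi_t\,d\mu(t)$, and for measurable $\tau:X\to[0,1]$ the weighted frame operator is $S_{\sqrt{\tau}\phi,X}f=\int_X\tau(t)\langle f,\phi_t\rangle\phi_t\,d\mu(t)$ (integrals defined weakly), $f\in\mathcal H$. *)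

(* Defs.v *)
From HB Require Import structures.
From mathcomp Require Import all_boot all_order all_algebra.
From mathcomp Require Import all_classical all_reals all_analysis.
From mathcomp.real_closed Require Import complex.

Set Implicit Arguments.
Unset Strict Implicit.
Unset Printing Implicit Defensive.

Import Order.TTheory GRing.Theory Num.Theory.
Local Open Scope classical_set_scope.
Local Open Scope ring_scope.

Definition is_inner_product (R : realType) (H : lmodType R[i])
    (ip : H -> H -> R[i]) : Prop :=
  [/\ (forall (a : R[i]) (f g h : H), ip (a *: f + g) h = a * ip f h + ip g h),
      (forall f g : H, ip g f = conjc (ip f g)),
      (forall f : H, complex.Im (ip f f) = 0 /\ 0 <= complex.Re (ip f f)) &
      (forall f : H, ip f f = 0 -> f = 0)].

Definition hnorm (R : realType) (H : lmodType R[i]) (ip : H -> H -> R[i])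
    (f : H) : R := Num.sqrt (complex.Re (ip f f)).

Definition ip_complete (R : realType) (H : lmodType R[i])
    (ip : H -> H -> R[i]) : Prop :=
  forall u : nat -> H,
    (forall e : R, 0 < e -> exists N : nat, forall m n : nat,
        (N <= m)%N -> (N <= n)%N -> hnorm ip (u m - u n) < e) ->
    exists l : H, forall e : R, 0 < e -> exists N : nat, forall n : nat,
        (N <= n)%N -> hnorm ip (u n - l) < e.

Definition ip_separable (R : realType) (H : lmodType R[i])
    (ip : H -> H -> R[i]) : Prop :=
  exists d : nat -> H, forall (f : H) (e : R), 0 < e ->
    exists n : nat, hnorm ip (f - d n) < e.

Definition separable_hilbert (R : realType) (H : lmodType R[i])
    (ip : H -> H -> R[i]) : Prop :=
  [/\ is_inner_product ip, ip_complete ip & ip_separable ip].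

Definition non_atomic (d : measure_display) (X : measurableType d)
    (R : realType) (mu : set X -> \bar R) : Prop :=
  forall A : set X, measurable A -> (0 < mu A)%E ->
    exists B : set X, [/\ measurable B, B `<=` A, (0 < mu B)%E & (mu B < mu A)%E].

Definition cmeasurable (d : measure_display) (X : measurableType d)
    (R : realType) (h : X -> R[i]) : Prop :=
  measurable_fun setT (fun t => complex.Re (h t)) /\
  measurable_fun setT (fun t => complex.Im (h t)).

Definition cintegral (d : measure_display) (X : measurableType d)
    (R : realType) (mu : {measure set X -> \bar R}) (D : set X)
    (h : X -> R[i]) : R[i] :=
  Complex (Rintegral mu D (fun t => complex.Re (h t)))
          (Rintegral mu D (fun t => complex.Im (h t))).

Definition cabs2 (R : realType) (z : R[i]) : R := complex.Re z ^+ 2 + complex.Im z ^+ 2.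

Definition continuous_bessel (d : measure_display) (X : measurableType d)
    (R : realType) (mu : {measure set X -> \bar R}) (H : lmodType R[i])
    (ip : H -> H -> R[i]) (phi : X -> H) (B : R) : Prop :=
  (forall f : H, cmeasurable (fun t => ip f (phi t))) /\
  (forall f : H, (\int[mu]_(t in setT) (cabs2 (ip f (phi t)))%:E
                    <= (B * hnorm ip f ^+ 2)%:E)%E).

Definition is_partial_frame_op (d : measure_display) (X : measurableType d)
    (R : realType) (mu : {measure set X -> \bar R}) (H : lmodType R[i])
    (ip : H -> H -> R[i]) (phi : X -> H) (E : set X) (S : H -> H) : Prop :=
  forall f g : H,
    ip (S f) g = cintegral mu E (fun t => ip f (phi t) * ip (phi t) g).

(* S is the (weakly defined) weighted frame operator S_{sqrt(tau) phi, X}: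
   <S f, g> = int_X tau(t) <f,phi_t><phi_t,g> dmu(t) *)
Definition is_weighted_frame_op (d : measure_display) (X : measurableType d)
    (R : realType) (mu : {measure set X -> \bar R}) (H : lmodType R[i])
    (ip : H -> H -> R[i]) (phi : X -> H) (tau : X -> R) (S : H -> H) : Prop :=
  forall f g : H,
    ip (S f) g = cintegral mu setT
                   (fun t => ((tau t)%:C)%C * (ip f (phi t) * ip (phi t) g)).

Definition opnorm_le (R : realType) (H : lmodType R[i])
    (ip : H -> H -> R[i]) (T : H -> H) (eps : R) : Prop :=
  forall f : H, hnorm ip (T f) <= eps * hnorm ip f.

(* Main.v *)
Require Import Defs.
From HB Require Import structures.
From mathcomp Require Import all_boot all_order all_algebra.
From mathcomp Require Import all_classical all_reals all_analysis.
From mathcomp.real_closed Require Import complex.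
From mathcomp Require Import measurable_realfun ring lra.
Import Order.TTheory GRing.Theory Num.Theory.
Local Open Scope classical_set_scope.
Local Open Scope ring_scope.

Set Implicit Arguments.
Unset Strict Implicit.
Unset Printing Implicit Defensive.

(** Separability splits [X] into countably many measurable pieces [F n] on each
    of which [phi] stays within [delta] of a constant vector [c n].  As [mu] is
    non-atomic, each [F n] contains a set of measure [\int_(F n) tau]; let [E] be
    the union of these, so that [s = \1_E - tau] has integral [0] on every [F n].
    Then [<(S1 - S2) f, g> = \int s <f, phi_t> <phi_t, g>] does not change when
    the constant [<f, c n> <c n, g>] is subtracted from the kernel on [F n], and
    what remains is [O(delta |f| |g|)] by the Bessel bound; take
    [g = (S1 - S2) f]. *)

(** * Riesz representation *)

Section RealInnerProduct.
Context (R : realType) (H : lmodType R[i]) (ip : H -> H -> R[i]).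
Hypothesis ipP : is_inner_product ip.

(** This is an inner product of [H] over the reals with the same norm, so all estimates stay in [R];
    the imaginary part of [ip] is recovered later by testing against ['i *: g]. *)
Definition rip (f g : H) : R := complex.Re (ip f g).

Lemma ip_conj f g : ip g f = conjc (ip f g).
Proof. by case: ipP. Qed.

Lemma ip0l g : ip 0 g = 0.
Proof.
case: ipP => lin _ _ _; have := lin (-1) 0 0 g.
by rewrite scaler0 addr0 mulN1r addNr.
Qed.

Lemma ipDl f g h : ip (f + g) h = ip f h + ip g h.
Proof. by case: ipP => lin _ _ _; have := lin 1 f g h; rewrite scale1r mul1r. Qed.

Lemma ipZl a f h : ip (a *: f) h = a * ip f h.
Proof. by case: ipP => lin _ _ _; have := lin a f 0 h; rewrite addr0 ip0l addr0. Qed.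

Lemma ripC f g : rip f g = rip g f.
Proof. by rewrite /rip ip_conj; case: (ip g f). Qed.

Lemma ripDl f g h : rip (f + g) h = rip f h + rip g h.
Proof. by rewrite /rip ipDl; case: (ip f h); case: (ip g h). Qed.

Lemma ripDr f g h : rip h (f + g) = rip h f + rip h g.
Proof. by rewrite ripC ripDl !(ripC h). Qed.

Lemma ripZl (r : R) f h : rip ((r%:C)%C *: f) h = r * rip f h.
Proof. by rewrite /rip ipZl; case: (ip f h) => x y /=; rewrite mul0r subr0. Qed.

Lemma ripZr (r : R) f h : rip h ((r%:C)%C *: f) = r * rip h f.
Proof. by rewrite ripC ripZl ripC. Qed.

Lemma rip0l h : rip 0 h = 0.
Proof. by rewrite /rip ip0l. Qed.

Lemma ripNl f h : rip (- f) h = - rip f h.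
Proof. by apply/eqP; rewrite -addr_eq0 -ripDl addNr rip0l. Qed.

Lemma ripNr f h : rip h (- f) = - rip h f.
Proof. by rewrite ripC ripNl ripC. Qed.

Lemma hnorm_ge0 f : 0 <= hnorm ip f.
Proof. exact: sqrtr_ge0. Qed.

Lemma hnorm_sqr f : hnorm ip f ^+ 2 = rip f f.
Proof. by rewrite sqr_sqrtr //; case: ipP => _ _ /(_ f) []. Qed.

Lemma rip_ge0 f : 0 <= rip f f.
Proof. by rewrite -hnorm_sqr sqr_ge0. Qed.

Lemma hnorm0_eq0 f : hnorm ip f = 0 -> f = 0.
Proof.
move=> f0; case: ipP => _ _ pos def; apply: def.
have := hnorm_sqr f; rewrite f0 expr0n /= /rip.
by case: (pos f); case: (ip f f) => x y /= -> _ <-.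
Qed.

Lemma hnorm_opp f : hnorm ip (- f) = hnorm ip f.
Proof. by rewrite /hnorm -!/(rip _ _) ripNl ripNr opprK. Qed.

(** Cauchy-Schwarz: [|G f - F g|^2 >= 0] expands to [2 F G (F G - rip f g) >= 0]. Vectors of norm 0
    are set apart so that [F G] can be cancelled. *)
Lemma rip_le f g : rip f g <= hnorm ip f * hnorm ip g.
Proof.
set F := hnorm ip f; set G := hnorm ip g.
have [F0|F0] := eqVneq F 0; first by rewrite (hnorm0_eq0 F0) rip0l F0 mul0r.
have [G0|G0] := eqVneq G 0; first by rewrite (hnorm0_eq0 G0) ripC rip0l G0 mulr0.
have FG0 : 0 < F * G by rewrite mulr_gt0 // lt0r ?F0 ?G0 hnorm_ge0.
have := rip_ge0 ((G%:C)%C *: f - (F%:C)%C *: g).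
rewrite !(ripDl, ripDr, ripNl, ripNr, ripZl, ripZr) (ripC g f).
rewrite -!hnorm_sqr -/F -/G => h.
rewrite -(ler_pM2l FG0); nra.
Qed.

(** Multiplying [f] by the conjugate of [ip f g] makes the product real, equal to [cabs2 (ip f g)];
    the real inequality is then squared and one factor [cabs2 (ip f g)] cancelled. *)
Lemma cabs2_ip_le f g : cabs2 (ip f g) <= hnorm ip f ^+ 2 * hnorm ip g ^+ 2.
Proof.
have [z0|z0] := eqVneq (cabs2 (ip f g)) 0.
  by rewrite z0 mulr_ge0 ?sqr_ge0.
have zgt0 : 0 < cabs2 (ip f g) by rewrite lt0r z0 addr_ge0 ?sqr_ge0.
set c := conjc (ip f g).
have Ec : rip (c *: f) g = cabs2 (ip f g).
  by rewrite /rip ipZl /c /cabs2; case: (ip f g) => x y /=; ring.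
have Nc : hnorm ip (c *: f) ^+ 2 = cabs2 (ip f g) * hnorm ip f ^+ 2.
  rewrite !hnorm_sqr /rip ipZl ip_conj ipZl.
  have : complex.Im (ip f f) = 0 by case: ipP => _ _ /(_ f) [].
  rewrite /c /cabs2; case: (ip f f) => u v /= ->; case: (ip f g) => x y /=; ring.
have := rip_le (c *: f) g; rewrite Ec.
rewrite -(ler_pXn2r (ltn0Sn 1)) ?nnegrE ?mulr_ge0 ?hnorm_ge0 ?(ltW zgt0)//.
by rewrite exprMn Nc expr2 -mulrA ler_pM2l.
Qed.

End RealInnerProduct.

(** * Bounded real-linear functionals on a Hilbert space *)

Section Riesz.
Context (R : realType) (H : lmodType R[i]) (ip : H -> H -> R[i]).
Hypothesis ipP : is_inner_product ip.
Hypothesis complete : ip_complete ip.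
Local Notation rip := (rip ip).
Local Notation hnorm := (hnorm ip).

(* The representing vector minimizes [v |-> |v|^2 - 2 l v]; minimizing
   sequences are Cauchy by the parallelogram law. *)
Lemma riesz_real (l : H -> R) (M : R) :
  (forall f g, l (f + g) = l f + l g) ->
  (forall (r : R) f, l ((r%:C)%C *: f) = r * l f) ->
  (forall f, `|l f| <= M * hnorm f) ->
  exists v, forall g, rip v g = l g.
Proof.
move=> lD lZ lM.
have Mle f : l f <= M * hnorm f := le_trans (ler_norm _) (lM f).
pose Q v := rip v v - 2 * l v.
have Qlb v : - M ^+ 2 <= Q v.
  have := Mle v; have := sqr_ge0 (hnorm v - M); rewrite /Q -hnorm_sqr//.
  nra.
have hi : has_inf (range Q).
  by split; [exists (Q 0), 0 | exists (- M ^+ 2) => _ [v _ <-]].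
set I := inf (range Q).
have Ile v : I <= Q v by apply: ge_inf; [case: hi | exists v].
have /choice[u uP] (n : nat) : exists v, Q v < I + n.+1%:R^-1.
  have [_ [v _ <-] ?] := inf_adherent (ltac:(by rewrite invr_gt0) : 0 < n.+1%:R^-1 :> R) hi.
  by exists v.
have small (e : R) : 0 < e -> exists N : nat, forall n, (N <= n)%N -> (n.+1%:R^-1 : R) < e.
  move=> e0; exists (Num.truncn e^-1) => n Nn.
  rewrite -[ltRHS]invrK ltf_pV2 ?posrE ?invr_gt0//.
  apply: lt_le_trans (truncnS_gt _) _; by rewrite ler_nat ltnS.
(* The square equals [2 Q (u m) + 2 Q (u n) - 4 Q w] with [w] the midpoint of [u m] and [u n], and
   [Q w >= I]. *)
have cau m n : hnorm (u m - u n) ^+ 2 <= 2 * m.+1%:R^-1 + 2 * n.+1%:R^-1.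
  have := Ile ((2^-1%:C)%C *: (u m + u n)); have := uP m; have := uP n.
  rewrite hnorm_sqr// /Q !lZ !lD !(ripDl, ripDr, ripNl, ripNr, ripZl, ripZr)//.
  rewrite (ripC ipP (u n) (u m)).
  move: (m.+1%:R^-1) (n.+1%:R^-1) => x y; lra.
have [v vP] : exists v, forall e : R, 0 < e -> exists N : nat, forall n,
    (N <= n)%N -> hnorm (u n - v) < e.
  apply: complete => e e0.
  have [N NP] := small (e ^+ 2 / 4) ltac:(by rewrite divr_gt0 ?exprn_gt0).
  exists N => m n /NP mN /NP nN.
  rewrite -(ltr_pXn2r (ltn0Sn 1)) ?nnegrE ?hnorm_ge0 ?(ltW e0)//.
  move: mN nN (cau m n); move: (m.+1%:R^-1) (n.+1%:R^-1) => x y; lra.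
have Qv : Q v <= I.
  apply/ler_addgt0Pr => e e0.
  (* [K] bounds the drop of [Q]: [Q v - Q (v + w) <= K |w|]. The summand 1 keeps it positive. *)
  pose K := 2 * hnorm v + 2 * `|M| + 1.
  have K0 : 0 < K by rewrite ltr_pwDr ?ltr01// addr_ge0 ?mulr_ge0 ?hnorm_ge0.
  have [N1 N1P] := vP (e / (2 * K)) ltac:(by rewrite divr_gt0// mulr_gt0).
  have [N2 N2P] := small (e / 2) ltac:(by rewrite divr_gt0).
  pose n := maxn N1 N2.
  have d2 := N1P n (leq_maxl _ _).
  have {}N2P := N2P n (leq_maxr _ _).
  set w := u n - v in d2.
  have unw : u n = v + w by rewrite /w addrC subrK.
  move: (uP n); rewrite unw => {unw}; clearbody w.
  have wK : hnorm w * K <= e / 2.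
    move: (ltW d2); rewrite ler_pdivlMr ?mulr_gt0//; lra.
  have := rip_le ipP (- w) v; rewrite ripNl// hnorm_opp//.
  have := Mle w.
  move: N2P; move: (n.+1%:R^-1) => x xe.
  rewrite /Q !lD !(ripDl, ripDr)// (ripC ipP w v).
  have w0 := hnorm_ge0 ip w.
  have : M * hnorm w <= `|M| * hnorm w by rewrite ler_wpM2r ?ler_norm.
  have := rip_ge0 ipP w; move: wK xe; rewrite /K.
  nra.
exists v => g; apply/eqP; rewrite -subr_eq0; apply/eqP.
set b := _ - _.
have quad (t : R) : 0 <= t ^+ 2 * rip g g + 2 * t * b.
  have := le_trans Qv (Ile (v + (t%:C)%C *: g)).
  rewrite /Q lD lZ !(ripDl, ripDr, ripZl, ripZr)// (ripC ipP g v) /b; nra.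
have gg := rip_ge0 ipP g.
(* A nearly optimal [t], at which the quadratic is [- (b / q)^2 (q + 1)]; the 1 in the denominator
   also covers [rip g g = 0]. *)
have := quad (- b / (1 + rip g g)).
have p : 0 < 1 + rip g g by lra.
set q := 1 + _ in p *.
have -> : rip g g = q - 1 by rewrite /q; ring.
have -> : (- b / q) ^+ 2 * (q - 1) + 2 * (- b / q) * b = - (b / q) ^+ 2 * (q + 1).
  by field; rewrite gt_eqF.
rewrite mulNr oppr_ge0 pmulr_lle0 ?ltr_wpDr// => b0.
have /eqP : (b / q) ^+ 2 == 0 by rewrite eq_le b0 sqr_ge0.
by move/eqP; rewrite sqrf_eq0 mulf_eq0 invr_eq0 (gt_eqF p) orbF => /eqP.
Qed.

End Riesz.

(** * Non-atomic measures *)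

Section NonAtomic.
Context (d : measure_display) (X : measurableType d) (R : realType)
  (mu : {finite_measure set X -> \bar R}).
Local Notation m A := (fine (mu A)).

Lemma fine_measureK A : measurable A -> ((m A)%:E = mu A)%E.
Proof. by move=> mA; rewrite fineK// fin_num_measure. Qed.

Lemma fine_measureU A B : measurable A -> measurable B -> A `&` B = set0 ->
  m (A `|` B) = m A + m B.
Proof. by move=> mA mB AB; rewrite measureU// fineD// fin_num_measure. Qed.

Lemma le_fine_measure A B : measurable A -> measurable B -> A `<=` B -> m A <= m B.
Proof.
by move=> mA mB AB; rewrite fine_le ?fin_num_measure// le_measure// inE.
Qed.

Hypothesis na : non_atomic mu.

(** Non-atomicity splits [A] into two pieces of positive measure, and one of them has at most half
    the measure. *)
Lemma nonatomic_half A : measurable A -> 0 < m A ->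
  exists B, [/\ measurable B, B `<=` A, 0 < m B & m B <= m A / 2].
Proof.
move=> mA; rewrite -lte_fin fine_measureK// => /(na mA)[B [mB BA]].
rewrite -(fine_measureK mA) -(fine_measureK mB) !lte_fin => B0 BltA.
have AE : m A = m B + m (A `\` B).
  rewrite -fine_measureU//; [|exact: measurableD|by rewrite setDIK].
  by rewrite setDUK.
have [Bh|Bh] := lerP (m B) (m A / 2); first by exists B; split.
exists (A `\` B); split => //; first exact: measurableD.
  by rewrite AE -ltrBlDl subrr in BltA.
by move: AE Bh; set u := m (A `\` B); set v := m B; lra.
Qed.

Lemma nonatomic_small A (e : R) : measurable A -> 0 < m A -> 0 < e ->
  exists B, [/\ measurable B, B `<=` A, 0 < m B & m B < e].
Proof.
move=> mA A0 e0.
have H n : exists B, [/\ measurable B, B `<=` A, 0 < m B & m B <= m A / 2 ^+ n].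
  elim: n => [|n [B [mB BA B0 Bn]]]; first by exists A; split => //; rewrite expr0 divr1.
  have [C [mC CB C0 Ch]] := nonatomic_half mB B0.
  exists C; split => //; first exact: subset_trans CB BA.
  apply: le_trans Ch _; rewrite exprSr invfM mulrA ler_pM2r//.
(* With [n] the integer part of [m A / e], [n] halvings suffice: [m A / e < n + 1 <= 2 ^ n]. *)
have [B [mB BA B0 Bn]] := H (Num.truncn (m A / e)).
exists B; split => //; apply: le_lt_trans Bn _.
rewrite ltr_pdivrMr ?exprn_gt0// mulrC -ltr_pdivrMr//.
apply: lt_le_trans (truncnS_gt _) _; rewrite -natrX ler_nat; exact: ltn_expl.
Qed.

(* Greedy exhaustion: each step adds at least half of the largest measure that
   still fits below [c], so a deficit in the union, filled by a small set [G],
   would have made every step gain at least [m G / 2]. *)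
Lemma sierpinski A (c : R) : measurable A -> 0 <= c <= m A ->
  exists E, [/\ measurable E, E `<=` A & mu E = c%:E].
Proof.
move=> mA /andP[c0 cA].
pose good E := [/\ measurable E, E `<=` A & m E <= c].
have /choice[next nextP] E : exists E', good E -> [/\ good E', E `<=` E' &
    forall G, measurable G -> G `<=` A `\` E -> m E + m G <= c ->
      m E + m G / 2 <= m E'].
  have [gE|] := pselect (good E); last by exists E.
  have [mE EA Ec] := gE.
  (* The measures of the sets that can still be added to [E] without exceeding [c]. *)
  pose S := [set m G | G in [set G | [/\ measurable G, G `<=` A `\` E & m E + m G <= c]]].
  have S0 : S 0 by exists set0; rewrite /= ?measure0//; split => //; rewrite ?measure0 ?addr0.
  have hS : has_sup S.
    split; first by exists 0.
    by exists (c - m E) => _ [G [_ _ ?] <-]; rewrite lerBrDl.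
  have supS G : measurable G -> G `<=` A `\` E -> m E + m G <= c -> m G <= sup S.
    by move=> mG GA Gc; apply: ub_le_sup; [case: hS|exists G].
  have [s0|s0] := lerP (sup S) 0.
    exists E => _; split => // G mG GA Gc.
    by have := supS G mG GA Gc; lra.
  (* The slack is [sup S / 2], so [F] has more than half the measure of any admissible [G]. *)
  have [_ [F [mF FA Fc] <-] sF] := sup_adherent (divr_gt0 s0 (ltr0Sn _ 1)) hS.
  have EF : E `&` F = set0.
    by rewrite -subset0 => x [Ex /FA[]].
  exists (E `|` F) => _; rewrite (fine_measureU mE mF EF); split.
  - split; [exact: measurableU| |by rewrite (fine_measureU mE mF EF)].
    by rewrite subUset; split => // x /FA[].
  - exact: subsetUl.
  - by move=> G mG GA Gc; have := supS G mG GA Gc; move: sF; lra.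
pose En n := iter n next set0.
have gE n : good (En n).
  elim: n => [|n /nextP[]//].
  by split => /=; rewrite ?measure0 ?c0 //.
have incE : nondecreasing_seq En.
  by apply/nondecreasing_seqP => n; apply/subsetPset; case: (nextP _ (gE n)).
have mE n : measurable (En n) by case: (gE n).
pose E := \bigcup_n En n.
have mEE : measurable E by exact: bigcup_measurable.
have EA : E `<=` A by apply: bigcup_sub => n _; case: (gE n).
have Ec : m E <= c.
  rewrite -lee_fin fine_measureK//.
  have cv : (mu \o En) @ \oo --> mu E by exact: nondecreasing_cvg_mu.
  rewrite -(cvg_lim _ cv)//; apply: lime_le; first by apply/cvg_ex; exists (mu E).
  by apply: nearW => n /=; rewrite -(fine_measureK (mE n)) lee_fin; case: (gE n).
exists E; split => //; rewrite -(fine_measureK mEE); congr EFin.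
apply/eqP; rewrite eq_le Ec /= leNgt; apply/negP => Elt.
have AE : m A = m E + m (A `\` E).
  rewrite -fine_measureU//; [|exact: measurableD|by rewrite setDIK].
  by rewrite setDUK.
have [G [mG GA G0 Gs]] := nonatomic_small (measurableD mA mEE)
  (ltac:(lra) : 0 < m (A `\` E)) (ltac:(lra) : 0 < c - m E).
have grow n : n%:R * (m G / 2) <= m (En n).
  elim: n => [|n IH]; first by rewrite mul0r measure0.
  have [_ _ /(_ G mG)] := nextP _ (gE n).
  have EnE : m (En n) <= m E by apply: le_fine_measure => //; exact: bigcup_sup.
  have GAn : G `<=` A `\` En n.
    by move=> x /GA[Ax nEx]; split => // Enx; apply: nEx; exists n.
  move=> /(_ GAn ltac:(lra)) h; apply: le_trans h.
  by rewrite -natr1 mulrDl mul1r lerD2r.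
pose N := (Num.truncn (c / (m G / 2))).+1.
have : c < N%:R * (m G / 2) by rewrite -ltr_pdivrMr ?truncnS_gt//; lra.
have [_ _ ENc] := gE N.
by have := grow N; lra.
Qed.

(** As [0 <= tau <= 1], the integral of [tau] over [F n] lies between 0 and [mu (F n)], so
    [sierpinski] applies on each piece. Disjointness keeps the chosen sets apart, and summing gives
    the total measure. *)
Lemma partition_set_of_density (tau : X -> R) (F : nat -> set X) :
  measurable_fun setT tau -> (forall t, 0 <= tau t <= 1) ->
  (forall n, measurable (F n)) -> trivIset setT F -> \bigcup_n F n = setT ->
  exists E, [/\ measurable E, mu E = (\int[mu]_t (tau t)%:E)%E &
    forall n, mu (E `&` F n) = (\int[mu]_(t in F n) (tau t)%:E)%E].
Proof.
move=> mtau tau01 mF tF cF.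
have tau0 t : (0 <= (tau t)%:E)%E by rewrite lee_fin; case/andP: (tau01 t).
have mtauE (D : set X) : measurable_fun D (fun t => (tau t)%:E).
  by apply/measurable_EFinP; apply: measurable_funTS.
have le n : (\int[mu]_(t in F n) (tau t)%:E <= mu (F n))%E.
  rewrite -[leRHS]mul1e -integral_cst//; apply: ge0_le_integral => //.
  by move=> t _; rewrite lee_fin; case/andP: (tau01 t).
have fin n : (\int[mu]_(t in F n) (tau t)%:E)%E \is a fin_num.
  rewrite ge0_fin_numE ?integral_ge0//.
  by rewrite (le_lt_trans (le n))// -ge0_fin_numE// fin_num_measure.
have /choice[E EP] n : exists E, [/\ measurable E, E `<=` F n &
    mu E = (\int[mu]_(t in F n) (tau t)%:E)%E].
  have [|E [mE EF muE]] := @sierpinski (F n) (fine (\int[mu]_(t in F n) (tau t)%:E)) (mF n).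
    by rewrite fine_ge0 ?integral_ge0// fine_le// fin_num_measure.
  by exists E; rewrite muE fineK.
have mE n : measurable (E n) by case: (EP n).
have EF n : E n `<=` F n by case: (EP n).
have EIF n : (\bigcup_k E k) `&` F n = E n.
  apply/seteqP; split => [t [[k _ Ekt] Fnt]|t Ent].
    have /(_ k n I I) <- // := tF.
    by exists t; split => //; exact: EF.
  by split; [exists n|exact: EF].
exists (\bigcup_n E n); split; first exact: bigcup_measurable.
- rewrite measure_bigcup//; last first.
    by move=> i j _ _ [t [/EF Ft /EF Ft']]; apply: tF => //; exists t.
  rewrite -cF ge0_integral_bigcup//.
  rewrite (eq_eseriesl (Q := xpredT)) => [|n]; last by rewrite in_setT.
  by apply: eq_eseriesr => n _; case: (EP n).
- by move=> n; rewrite EIF; case: (EP n).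
Qed.

End NonAtomic.

(** Reduces a global inequality to the pieces, where a different correction may be made on each
    without studying the integrability of the glued correction. *)
Lemma integral_ge0_partition (d : measure_display) (X : measurableType d) (R : realType)
    (mu : {measure set X -> \bar R}) (F : nat -> set X) (h : X -> R) :
  (forall n, measurable (F n)) -> trivIset setT F -> \bigcup_n F n = setT ->
  mu.-integrable setT (EFin \o h) ->
  (forall n, 0 <= \int[mu]_(t in F n) h t) -> 0 <= \int[mu]_t h t.
Proof.
move=> mF tF cF ih h0; rewrite /Rintegral fine_ge0//.
rewrite -cF integral_bigcup//; last by rewrite cF.
apply: nneseries_ge0 => n _ _.
have := h0 n; rewrite /Rintegral -lee_fin fineK//.
by apply: integrable_fin_num => //; apply: integrableS ih.
Qed.

(** * Frame operators *)

Section Cdot.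
Context (R : realType).
Implicit Types x y : R[i].

Lemma cabs2_ge0 (z : R[i]) : 0 <= cabs2 z.
Proof. by rewrite addr_ge0 ?sqr_ge0. Qed.

(** The real part of [x] times the conjugate of [y], that is, the scalar product in the plane. *)
Definition cdot x y : R :=
  complex.Re x * complex.Re y + complex.Im x * complex.Im y.

(** Young's inequality, from [c (|p| - |q| / c)^2 >= 0] in each coordinate. The weight [c] is left
    free to balance the two terms in each use. *)
Lemma cdot_le (c : R) x y : 0 < c ->
  `|cdot x y| <= (c * cabs2 x + c^-1 * cabs2 y) / 2.
Proof.
move=> c0; have cK : c * c^-1 = 1 by rewrite divff ?gt_eqF.
have aux (p q : R) : `|p * q| <= (c * p ^+ 2 + c^-1 * q ^+ 2) / 2.
  have := mulr_ge0 (ltW c0) (sqr_ge0 (`|p| - c^-1 * `|q|)).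
  rewrite normrM -(real_normK (num_real p)) -(real_normK (num_real q)).
  have -> : c * (`|p| - c^-1 * `|q|) ^+ 2 =
     c * `|p| ^+ 2 - 2 * (c * c^-1) * `|p| * `|q| + (c * c^-1) * c^-1 * `|q| ^+ 2 by ring.
  rewrite cK; lra.
apply: le_trans (ler_normD _ _) _.
apply: le_trans (lerD (aux _ _) (aux _ _)) _.
by rewrite /cabs2 le_eqVlt; apply/orP; left; apply/eqP; ring.
Qed.

(** On the right [x'] and [y'] enter only through differences: in the application the Bessel bound
    controls [x] and [y], and closeness of [phi t] to [c] controls the differences. *)
Lemma cdotB x x' y y' :
  cdot x y - cdot x' y' = cdot (x - x') y + cdot x (y - y') - cdot (x - x') (y - y').
Proof. by rewrite /cdot; case: x x' y y' => [? ?] [? ?] [? ?] [? ?] /=; ring. Qed.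

Lemma ReZ (r : R) x : complex.Re ((r%:C)%C * x) = r * complex.Re x.
Proof. by case: x => ? ? /=; ring. Qed.

Lemma ImZ (r : R) x : complex.Im ((r%:C)%C * x) = r * complex.Im x.
Proof. by case: x => ? ? /=; ring. Qed.

Lemma cdot0r x : cdot x 0 = 0.
Proof. by rewrite /cdot /= !mulr0 addr0. Qed.

End Cdot.

(** * Weak integrals of a Bessel family *)

Section Frame.
Context (d : measure_display) (X : measurableType d) (R : realType)
  (mu : {finite_measure set X -> \bar R}) (H : lmodType R[i])
  (ip : H -> H -> R[i]) (phi : X -> H) (B : R).
Hypothesis ipP : is_inner_product ip.
Hypothesis bessel : continuous_bessel mu ip phi B.
Local Notation rip := (rip ip).
Local Notation hnorm := (hnorm ip).
Local Notation coef f t := (ip f (phi t)).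

Lemma measurable_cabs2_coef f : measurable_fun setT (fun t => cabs2 (coef f t)).
Proof.
case: bessel => /(_ f)[mr mi] _; rewrite /cabs2.
by apply: measurable_funD; apply: measurable_funX.
Qed.

Lemma measurable_cdot_coef f g :
  measurable_fun setT (fun t => cdot (coef f t) (coef g t)).
Proof.
case: bessel => m _; have [fr fi] := m f; have [gr gi] := m g.
by rewrite /cdot; apply: measurable_funD; apply: measurable_funM.
Qed.

Lemma integrable_cabs2_coef f :
  mu.-integrable setT (EFin \o (fun t => cabs2 (coef f t))).
Proof.
apply/integrableP; split; first exact/measurable_EFinP/measurable_cabs2_coef.
under eq_integral do rewrite /= ger0_norm ?cabs2_ge0//.
by case: bessel => _ /(_ f) /le_lt_trans; apply; exact: ltry.
Qed.

Lemma Rintegral_cabs2_coef_le f :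
  \int[mu]_t cabs2 (coef f t) <= B * hnorm f ^+ 2.
Proof.
rewrite -lee_fin /Rintegral fineK; first by case: bessel.
by apply: integrable_fin_num => //; exact: integrable_cabs2_coef.
Qed.

Lemma integrable_weighted (w : X -> R) f g :
  measurable_fun setT w -> (forall t, `|w t| <= 1) ->
  mu.-integrable setT (EFin \o (fun t => w t * cdot (coef f t) (coef g t))).
Proof.
move=> mw w1.
apply: (@le_integrable _ _ _ _ _ measurableT _
   (EFin \o (fun t => cabs2 (coef f t) + cabs2 (coef g t)))).
- apply/measurable_EFinP; apply: measurable_funM => //.
  exact: measurable_cdot_coef.
- move=> t _ /=; rewrite lee_fin normrM.
  have p z : 0 <= cabs2 (z : R[i]) := cabs2_ge0 z.
  rewrite (ger0_norm (addr_ge0 (p _) (p _))).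
  apply: le_trans (ler_piMl _ (w1 t)) _ => //.
  apply: le_trans (cdot_le _ _ ltr01) _; rewrite invr1 !mul1r.
  by have := p (ip f (phi t)); have := p (ip g (phi t)); lra.
- have := integrableD measurableT (integrable_cabs2_coef f) (integrable_cabs2_coef g).
  by apply: eq_integrable.
Qed.

Lemma Re_kernel f g t :
  complex.Re (ip f (phi t) * ip (phi t) g) = cdot (coef f t) (coef g t).
Proof.
rewrite (ip_conj ipP g (phi t)) /cdot.
by case: (ip f _) (ip g _) => [? ?] [? ?] /=; rewrite mulrN opprK.
Qed.

Lemma ip_Zi f g : ip f ('i%C *: g) = - 'i%C * ip f g.
Proof.
rewrite (ip_conj ipP) (ipZl ipP) (ip_conj ipP g f).
by case: (ip g f) => x y /=; congr Complex; ring.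
Qed.

(** Since [Re (- i z) = Im z], replacing [g] by [i g] turns the imaginary part into a real one, so
    integrals of [cdot] determine the weak operators. *)
Lemma Im_kernel f g t : complex.Im (ip f (phi t) * ip (phi t) g) =
  cdot (coef f t) (coef ('i%C *: g) t).
Proof.
rewrite -Re_kernel ip_Zi.
by case: (ip f _) (ip _ g) => [? ?] [? ?] /=; ring.
Qed.

Lemma rip_Zi f g : rip f ('i%C *: g) = complex.Im (ip f g).
Proof. by rewrite /rip ip_Zi; case: (ip f g) => x y /=; ring. Qed.

Lemma cdot_coefDr f g h t :
  cdot (coef f t) (coef (g + h) t) = cdot (coef f t) (coef g t) + cdot (coef f t) (coef h t).
Proof.
by rewrite (ipDl ipP) /cdot; case: (ip g _) (ip h _) => [? ?] [? ?] /=; ring.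
Qed.

Lemma cdot_coefZr f (r : R) g t :
  cdot (coef f t) (coef ((r%:C)%C *: g) t) = r * cdot (coef f t) (coef g t).
Proof. by rewrite (ipZl ipP) /cdot; case: (ip g _) => [? ?] /=; ring. Qed.

(** Young's inequality with weight [|g|], followed by the Bessel bound, gives a bound linear in
    [|g|]. Its dependence on [f] is harmless, as Riesz is applied for each fixed [f]. *)
Lemma normr_Rintegral_weighted_le (w : X -> R) f g :
  measurable_fun setT w -> (forall t, `|w t| <= 1) ->
  `|\int[mu]_t (w t * cdot (coef f t) (coef g t))| <=
  B * (hnorm f ^+ 2 + 1) / 2 * hnorm g.
Proof.
move=> mw w1.
have [g0|g0] := eqVneq (hnorm g) 0.
  rewrite g0 mulr0 (hnorm0_eq0 ipP g0).
  under eq_Rintegral do rewrite (ip0l ipP) cdot0r mulr0.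
  by rewrite Rintegral_cst// mul0r normr0.
have {}g0 : 0 < hnorm g by rewrite lt0r g0 hnorm_ge0.
apply: le_trans (le_normr_Rintegral _ (integrable_weighted _ _ _ _)) _ => //.
have iZ (c : R) h : mu.-integrable setT (EFin \o (fun t => c * cabs2 (coef h t))).
  by apply: eq_integrable (integrableZl measurableT c (integrable_cabs2_coef h)).
pose G := hnorm g.
apply: (@le_trans _ _ (\int[mu]_t (G / 2 * cabs2 (coef f t) + G^-1 / 2 * cabs2 (coef g t)))).
  apply: le_Rintegral => //.
  - have /integrable_abse := integrable_weighted f g mw w1.
    by apply: eq_integrable.
  - by have := integrableD measurableT (iZ (G / 2) f) (iZ (G^-1 / 2) g); apply: eq_integrable.
  - move=> t _; rewrite normrM; apply: le_trans (ler_piMl _ (w1 t)) _ => //.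
    apply: le_trans (cdot_le _ _ g0) _.
    by rewrite le_eqVlt; apply/orP; left; apply/eqP; rewrite -/G; ring.
rewrite RintegralD//; try exact: iZ.
rewrite !RintegralZl//; try exact: integrable_cabs2_coef.
have G2 : 0 <= G / 2 by rewrite divr_ge0// ltW.
have G3 : 0 <= G^-1 / 2 by rewrite divr_ge0// invr_ge0 ltW.
apply: le_trans (lerD (ler_wpM2l G2 (Rintegral_cabs2_coef_le f))
  (ler_wpM2l G3 (Rintegral_cabs2_coef_le g))) _.
rewrite le_eqVlt; apply/orP; left; apply/eqP; rewrite -/G; field.
exact: lt0r_neq0.
Qed.

(** * Existence of the operators and stability of the kernel *)

Hypothesis complete : ip_complete ip.

Lemma weighted_frame_op_exists (w : X -> R) :
  measurable_fun setT w -> (forall t, `|w t| <= 1) ->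
  exists S, is_weighted_frame_op mu ip phi w S.
Proof.
move=> mw w1.
have /choice[S SP] f : exists v, forall g,
    rip v g = \int[mu]_t (w t * cdot (coef f t) (coef g t)).
  apply: (riesz_real ipP complete (M := B * (hnorm f ^+ 2 + 1) / 2)); last first.
    by move=> g; exact: normr_Rintegral_weighted_le.
  - move=> r g /=; rewrite -RintegralZl//; try exact: integrable_weighted.
    by apply: eq_Rintegral => t _; rewrite cdot_coefZr mulrCA.
  - move=> g h /=; rewrite -RintegralD//; try exact: integrable_weighted.
    by apply: eq_Rintegral => t _; rewrite cdot_coefDr mulrDr.
exists S => f g; rewrite /cintegral.
(* Riesz gives only real parts; the imaginary part is the real part against [i g]. *)
transitivity (Complex (rip (S f) g) (rip (S f) ('i%C *: g))).
  by rewrite rip_Zi /rip; case: (ip (S f) g).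
by rewrite !SP; congr Complex; apply: eq_Rintegral => t _;
  rewrite ?(ReZ, ImZ) ?Re_kernel ?Im_kernel.
Qed.

Lemma weighted_frame_op_rip (w : X -> R) S f g : is_weighted_frame_op mu ip phi w S ->
  rip (S f) g = \int[mu]_t (w t * cdot (coef f t) (coef g t)).
Proof.
move=> SP; rewrite /rip SP /cintegral /=; apply: eq_Rintegral => t _.
by rewrite ReZ Re_kernel.
Qed.

(** With weight [\1_E], the partial operator comes from the same existence result as the weighted
    one. *)
Lemma partial_frame_op_indic (E : set X) S : measurable E ->
  is_weighted_frame_op mu ip phi (\1_E) S -> is_partial_frame_op mu ip phi E S.
Proof.
move=> mE SP f g; rewrite SP /cintegral !(Rintegral_mkcond _ E).
by congr Complex; apply: eq_Rintegral => t _; rewrite patchE indicE ?(ReZ, ImZ);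
  case: ifP => _; rewrite ?mul1r ?mul0r.
Qed.

(* The difference of the two kernels [<f,phi_t><phi_t,g>] and [<f,c><c,g>] is
   estimated by AM-GM, with weights making all terms multiples of [|f||g|]. *)
Lemma kernel_perturbation (delta : R) f g (t : X) (c : H) :
  0 < delta -> 0 < hnorm f -> 0 < hnorm g -> hnorm (phi t - c) <= delta ->
  `|cdot (coef f t) (coef g t) - cdot (ip f c) (ip g c)| <=
  delta / 2 * (hnorm f / hnorm g) * cabs2 (coef g t)
  + delta / 2 * (hnorm g / hnorm f) * cabs2 (coef f t)
  + (delta + delta ^+ 2) * (hnorm f * hnorm g).
Proof.
move=> d0 F0 G0 td.
set F := hnorm f in F0 *; set G := hnorm g in G0 *.
have Bd h : cabs2 (ip h (phi t) - ip h c) <= delta ^+ 2 * hnorm h ^+ 2.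
  have -> : ip h (phi t) - ip h c = ip h (phi t - c).
    rewrite !(ip_conj ipP _ h) (ipDl ipP) -scaleN1r (ipZl ipP) mulN1r.
    by rewrite -raddfB.
  apply: le_trans (cabs2_ip_le ipP _ _) _; rewrite mulrC ler_wpM2r ?sqr_ge0//.
  by rewrite ler_pXn2r// nnegrE ?hnorm_ge0 ?ltW.
have Bf := Bd f; have Bg := Bd g; rewrite -/F -/G in Bf Bg.
rewrite cdotB.
set u := ip f _ - _ in Bf *; set v := ip g _ - _ in Bg *.
set a := ip f (phi t); set b := ip g (phi t).
have F1 : F != 0 by rewrite gt_eqF.
have G1 : G != 0 by rewrite gt_eqF.
have D1 : delta != 0 by rewrite gt_eqF.
have c1 : 0 < G / (delta * F) by rewrite divr_gt0 ?mulr_gt0.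
have c2 : 0 < delta * G / F by rewrite divr_gt0 ?mulr_gt0.
have c3 : 0 < G / F by rewrite divr_gt0.
have e1 := cdot_le u b c1.
have e2 := cdot_le a v c2.
have e3 := cdot_le u v c3.
have s1 := ler_wpM2l (ltW c1) Bf.
have s2 : (delta * G / F)^-1 * cabs2 v <= (delta * G / F)^-1 * (delta ^+ 2 * G ^+ 2).
  by rewrite ler_wpM2l// invr_ge0 ltW.
have s3 := ler_wpM2l (ltW c3) Bf.
have s4 : (G / F)^-1 * cabs2 v <= (G / F)^-1 * (delta ^+ 2 * G ^+ 2).
  by rewrite ler_wpM2l// invr_ge0 ltW.
have E1 : G / (delta * F) * (delta ^+ 2 * F ^+ 2) = delta * (F * G) by field; apply/andP.
have E2 : (delta * G / F)^-1 * (delta ^+ 2 * G ^+ 2) = delta * (F * G).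
  by field; apply/and3P.
have E3 : G / F * (delta ^+ 2 * F ^+ 2) = delta ^+ 2 * (F * G) by field.
have E4 : (G / F)^-1 * (delta ^+ 2 * G ^+ 2) = delta ^+ 2 * (F * G).
  by field; apply/andP.
have E5 : (G / (delta * F))^-1 * cabs2 b = delta * (F / G) * cabs2 b by field; apply/and3P.
have E6 : delta * G / F * cabs2 a = delta * (G / F) * cabs2 a by field.
rewrite E1 in s1; rewrite E2 in s2; rewrite E3 in s3; rewrite E4 in s4.
rewrite E5 in e1; rewrite E6 in e2.
apply: le_trans (ler_normB _ _) _; apply: le_trans (lerD (ler_normD _ _) (lexx _)) _.
move: (`|cdot u b|) (`|cdot a v|) (`|cdot u v|) e1 e2 e3 => x y z.
lra.
Qed.

Lemma perturbed_integral_le (delta : R) (s : X -> R) (F : nat -> set X) (c : nat -> H) f g :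
  0 < delta -> 0 < hnorm f -> 0 < hnorm g ->
  measurable_fun setT s -> (forall t, `|s t| <= 1) ->
  (forall n, measurable (F n)) -> trivIset setT F -> \bigcup_n F n = setT ->
  (forall n t, F n t -> hnorm (phi t - c n) <= delta) ->
  (forall n, \int[mu]_(t in F n) s t = 0) ->
  \int[mu]_t (s t * cdot (coef f t) (coef g t)) <=
  (delta * B + (delta + delta ^+ 2) * fine (mu setT)) * (hnorm f * hnorm g).
Proof.
move=> d0 F0 G0 ms s1 mF tF cF Fd sF.
pose ka := delta / 2 * (hnorm f / hnorm g).
pose kb := delta / 2 * (hnorm g / hnorm f).
pose kc := (delta + delta ^+ 2) * (hnorm f * hnorm g).
(* The majorant of [kernel_perturbation], the same on all pieces; the Bessel bound turns its
   integral into the claimed constant. *)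
pose K t := ka * cabs2 (coef g t) + kb * cabs2 (coef f t) + kc.
have iZ (k : R) h : mu.-integrable setT (EFin \o (fun t => k * cabs2 (coef h t))).
  by apply: eq_integrable (integrableZl measurableT k (integrable_cabs2_coef h)).
have icst (k : R) : mu.-integrable setT (EFin \o (fun _ : X => k)).
  exact: finite_measure_integrable_cst.
have iZZ : mu.-integrable setT
    (EFin \o (fun t => ka * cabs2 (coef g t) + kb * cabs2 (coef f t))).
  by have := integrableD measurableT (iZ ka g) (iZ kb f); apply: eq_integrable.
have iK : mu.-integrable setT (EFin \o K).
  by have := integrableD measurableT iZZ (icst kc); apply: eq_integrable.
have iw := integrable_weighted f g ms s1.
have is_ : mu.-integrable setT (EFin \o s).
  apply: (@le_integrable _ _ _ _ _ measurableT _ (EFin \o (fun=> 1))) => //.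
    exact/measurable_EFinP.
  by move=> t _ /=; rewrite lee_fin normr1.
have : 0 <= \int[mu]_t (K t - s t * cdot (coef f t) (coef g t)).
  apply: (integral_ge0_partition mF tF cF).
    by have := integrableB measurableT iK iw; apply: eq_integrable.
  move=> n; pose p := cdot (ip f (c n)) (ip g (c n)).
  have FS Y h : measurable Y -> mu.-integrable setT h -> mu.-integrable Y h.
    by move=> mY; apply: integrableS.
  have ip_ : mu.-integrable setT (EFin \o (fun t => s t * p)).
    by have := integrableZr measurableT p is_; apply: eq_integrable.
  (* Adding [s t * p] is free because [s] has integral 0 on [F n]; it makes the integrand
     nonnegative pointwise. *)
  have -> : \int[mu]_(t in F n) (K t - s t * cdot (coef f t) (coef g t)) =
     \int[mu]_(t in F n) ((K t - s t * cdot (coef f t) (coef g t)) + s t * p).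
    rewrite [RHS]RintegralD//; last 2 first.
    - apply: FS => //.
      by have := integrableB measurableT iK iw; apply: eq_integrable.
    - exact: FS.
    by rewrite RintegralZr ?sF ?mul0r ?addr0//; exact: FS.
  apply: Rintegral_ge0 => t Ft.
  have := kernel_perturbation d0 F0 G0 (Fd n t Ft); rewrite -/p -/(K t).
  set k := cdot (coef f t) _ => kp.
  have -> : K t - s t * k + s t * p = K t - s t * (k - p) by ring.
  rewrite subr_ge0; apply: le_trans (ler_norm _) _.
  by rewrite normrM; apply: le_trans kp; rewrite ler_piMl.
rewrite RintegralB// subr_ge0 => /le_trans; apply.
rewrite /K RintegralD// RintegralD//; try exact: iZ.
rewrite !RintegralZl//; try exact: integrable_cabs2_coef.
rewrite Rintegral_cst//.
have ka0 : 0 <= ka by rewrite mulr_ge0 ?divr_ge0 ?ltW.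
have kb0 : 0 <= kb by rewrite mulr_ge0 ?divr_ge0 ?ltW.
apply: le_trans (lerD (lerD (ler_wpM2l ka0 (Rintegral_cabs2_coef_le g))
  (ler_wpM2l kb0 (Rintegral_cabs2_coef_le f))) (lexx _)) _.
rewrite le_eqVlt; apply/orP; left; apply/eqP; rewrite /ka /kb /kc; field.
by rewrite !gt_eqF.
Qed.

(** * Partitions on which the family oscillates little *)

Hypothesis sep : ip_separable ip.

(** Only the scalar functions [ip f (phi t)] are known to be measurable, so the ball is written as a
    countable intersection of half-spaces: [|x| <= r] iff [rip (e n) x <= r |e n|] along a dense
    sequence [e]. *)
Lemma measurable_ball_preimage (c : H) (r : R) : 0 <= r ->
  measurable [set t | hnorm (phi t - c) <= r].
Proof.
move=> r0; have [e eP] := sep.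
have -> : [set t | hnorm (phi t - c) <= r] =
    \bigcap_n [set t | rip (e n) (phi t) <= r * hnorm (e n) + rip (e n) c].
  apply/seteqP; split => t /=.
    move=> tr n _ /=; rewrite -lerBlDr -ripNr// -ripDr//.
    apply: le_trans (rip_le ipP _ _) _.
    by rewrite mulrC ler_wpM2r ?hnorm_ge0.
  move=> tP; set x := phi t - c.
  have {}tP n : rip (e n) x <= r * hnorm (e n).
    by have := tP n I; rewrite /= /x ripDr// ripNr// lerBlDr.
  clearbody x; have x0 := hnorm_ge0 ip x.
  rewrite leNgt; apply/negP => rx.
  have xgt : 0 < hnorm x by exact: le_lt_trans rx.
  (* For [e n = x - y] the half-space inequality fails once [|y| (|x| + r) < (|x| - r) |x|]; [eta]
     is half the resulting threshold on [|y|]. *)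
  pose eta := (hnorm x - r) * hnorm x / (2 * (hnorm x + r)).
  have s0 : 0 < hnorm x + r by lra.
  have eta0 : 0 < eta by rewrite divr_gt0 ?mulr_gt0// subr_gt0.
  have [n] := eP x eta eta0.
  set y := x - e n => ylt.
  have en : e n = x - y by rewrite /y opprB addrC subrK.
  have := tP n; rewrite en; clearbody y => {en}; rewrite ripDl// ripNl// -hnorm_sqr//.
  have yx := rip_le ipP y x.
  have nd : hnorm (x - y) <= hnorm x + hnorm y.
    rewrite -(ler_pXn2r (ltn0Sn 1)) ?nnegrE ?addr_ge0 ?hnorm_ge0//.
    rewrite hnorm_sqr// !(ripDl, ripDr, ripNl, ripNr)// (ripC ipP y x).
    have := rip_le ipP (- x) y; rewrite ripNl// hnorm_opp//.
    by rewrite -!hnorm_sqr//; lra.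
  have ey : hnorm y * (hnorm x + r) < (hnorm x - r) * hnorm x.
    have : eta * (hnorm x + r) = (hnorm x - r) * hnorm x / 2.
      by rewrite /eta; field; rewrite gt_eqF.
    have := ltr_pM2r s0 (hnorm y) eta; rewrite ylt => h1 h2.
    have : 0 < (hnorm x - r) * hnorm x by rewrite mulr_gt0// subr_gt0.
    by move: h1 => /idP; rewrite h2; lra.
  have := ler_wpM2l r0 nd; nra.
apply: bigcapT_measurable => n.
rewrite -[X in measurable X]setTI; apply: measurable_fun_le => //.
by case: bessel => /(_ (e n))[].
Qed.

(** The balls of radius [delta] about a dense sequence cover [H]; [seqDU] makes their preimages
    disjoint. *)
Lemma small_oscillation_partition (delta : R) : 0 < delta ->
  exists (F : nat -> set X) (c : nat -> H),
  [/\ forall n, measurable (F n), trivIset setT F, \bigcup_n F n = setT &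
      forall n t, F n t -> hnorm (phi t - c n) <= delta].
Proof.
move=> d0; have [e eP] := sep.
pose Y n := [set t | hnorm (phi t - e n) <= delta].
exists (seqDU Y), e; split.
- by move=> n; apply: seqDU_measurable => k; apply: measurable_ball_preimage; exact: ltW.
- exact: trivIset_seqDU.
- rewrite -seqDU_bigcup_eq; apply/seteqP; split => // t _.
  by have [n /ltW ?] := eP (phi t) delta d0; exists n.
- by move=> n t Ft; exact: (@subset_seqDU _ Y n t Ft).
Qed.

End Frame.

(** * Choice of the set and the norm estimate *)

Theorem theorem3p6 (d : measure_display) (X : measurableType d)
  (R : realType) (mu : {finite_measure set X -> \bar R})
  (H : lmodType R[i]) (ip : H -> H -> R[i]) (phi : X -> H) (B : R) :
  non_atomic mu ->
  separable_hilbert ip ->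
  continuous_bessel mu ip phi B ->
  forall tau : X -> R,
    measurable_fun setT tau ->
    (forall t, 0 <= tau t <= 1) ->
  forall eps : R, 0 < eps ->
  exists E : set X,
    [/\ measurable E,
        (mu E <= \int[mu]_(t in setT) (tau t)%:E)%E &
        exists S1 S2 : H -> H,
          [/\ is_partial_frame_op mu ip phi E S1,
              is_weighted_frame_op mu ip phi tau S2 &
              opnorm_le ip (fun f => S1 f - S2 f) eps]].
Proof.
move=> na [ipP complete sep] bessel tau mtau tau01 eps eps0.
(* For [delta <= 1], the constant [delta B + (delta + delta^2) mu(X)] is at most [delta b]. The
   absolute value covers any sign of [B], and the 1 makes [b] positive. *)
pose b := `|B| + 2 * fine (mu setT) + 1.
have b1 : 1 <= b.
  by rewrite lerDr addr_ge0// mulr_ge0// fine_ge0.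
have b0 : 0 < b by exact: lt_le_trans b1.
pose delta := Num.min 1 (eps / b).
have delta0 : 0 < delta by rewrite lt_min ltr01 divr_gt0.
have [F [c [mF tF cF Fc]]] := small_oscillation_partition ipP bessel sep delta0.
have [E [mE muE muEF]] := partition_set_of_density na mtau tau01 mF tF cF.
have m1E : measurable_fun setT (\1_E : X -> R) by exact: measurable_indic.
have tau_le1 t : `|tau t| <= 1.
  by have /andP[? ?] := tau01 t; rewrite ger0_norm.
have indic_le1 t : `|\1_E t : R| <= 1.
  by rewrite indicE; case: (_ \in _); rewrite ?normr1 ?normr0.
have [S1 S1P] := weighted_frame_op_exists ipP bessel complete m1E indic_le1.
have [S2 S2P] := weighted_frame_op_exists ipP bessel complete mtau tau_le1.
exists E; split; [exact: mE | by rewrite muE |].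
exists S1, S2; split; [exact: partial_frame_op_indic | exact: S2P |].
move=> f; set g := S1 f - S2 f.
(* The operators are given only by their weak integrals, so for [f = 0] the vanishing of [g] is read
   off from these. *)
have [f0|f0] := eqVneq (hnorm ip f) 0.
  suff -> : g = 0 by rewrite f0 mulr0 /hnorm -/(rip ip 0 0) rip0l// sqrtr0.
  apply: (hnorm0_eq0 ipP); apply/eqP; rewrite -sqrf_eq0 hnorm_sqr//.
  rewrite {1}/g ripDl// ripNl//.
  rewrite (weighted_frame_op_rip ipP _ _ S1P) (weighted_frame_op_rip ipP _ _ S2P).
  rewrite (hnorm0_eq0 ipP f0) (@eq_Rintegral _ _ _ _ _ (fun=> 0)); last first.
    by move=> t _; rewrite ip0l// /cdot /= !mul0r addr0 mulr0.
  rewrite [X in _ - X](@eq_Rintegral _ _ _ _ _ (fun=> 0)) ?subrr// => t _.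
  by rewrite ip0l// /cdot /= !mul0r addr0 mulr0.
have [g0|g0] := eqVneq (hnorm ip g) 0.
  by rewrite g0 mulr_ge0 ?hnorm_ge0 ?ltW.
have {}f0 : 0 < hnorm ip f by rewrite lt0r f0 hnorm_ge0.
have {}g0 : 0 < hnorm ip g by rewrite lt0r g0 hnorm_ge0.
pose s t : R := \1_E t - tau t.
have ms : measurable_fun setT s by exact: measurable_funB.
have s1 t : `|s t| <= 1.
  have /andP[? ?] := tau01 t; rewrite /s indicE ler_norml.
  by case: (_ \in _) => /=; lra.
have itau : mu.-integrable setT (EFin \o tau).
  apply: (@le_integrable _ _ _ _ _ measurableT _ (EFin \o (fun=> 1))).
  - exact/measurable_EFinP.
  - by move=> t _ /=; rewrite lee_fin normr1.
  - exact: finite_measure_integrable_cst.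
have iE : mu.-integrable setT (EFin \o (\1_E : X -> R)).
  exact: integrable_indic.
have sF n : \int[mu]_(t in F n) s t = 0.
  rewrite RintegralB//; last 2 first.
  - exact: integrableS iE.
  - exact: integrableS itau.
  apply/eqP; rewrite subr_eq0; apply/eqP.
  by rewrite /Rintegral -muEF integral_indic// setIC.
have key := perturbed_integral_le ipP bessel delta0 f0 g0 ms s1 mF tF cF Fc sF.
have gE : hnorm ip g ^+ 2 =
    \int[mu]_t (s t * cdot (ip f (phi t)) (ip g (phi t))).
  rewrite hnorm_sqr// {1}/g ripDl// ripNl//.
  rewrite (weighted_frame_op_rip ipP _ _ S1P) (weighted_frame_op_rip ipP _ _ S2P).
  rewrite -RintegralB//; try exact: (integrable_weighted bessel).
  by apply: eq_Rintegral => t _; rewrite -mulrBl.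
(* The estimate now reads [|g|^2 <= C |f| |g|], and one factor [|g|] cancels. *)
move: key; rewrite -gE expr2 mulrA ler_pM2r// => key.
apply: le_trans key _; rewrite ler_wpM2r ?hnorm_ge0//.
have delta1 : delta <= 1 by rewrite ge_min lexx.
have deltab : delta * b <= eps by rewrite -ler_pdivlMr// ge_min lexx orbT.
apply: le_trans deltab.
have mX : 0 <= fine (mu setT) by rewrite fine_ge0.
have e1 : delta * B <= delta * `|B| by rewrite ler_wpM2l ?ler_norm ?ltW.
have e2 : delta ^+ 2 * fine (mu setT) <= delta * fine (mu setT).
  by rewrite ler_wpM2r// expr2 ler_piMl// ltW.
rewrite /b; lra.
Qed.
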